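(* Completely positive maps into matrix algebras distinguish morphisms of operator systems. That is: if $S$ and $T$ are operator systems (in the nonunital sense defined in the context) and $f,g\colon S\to T$ are morphisms of operator systems with $f\neq g$, then there exist $k\in\mathbb{N}$ and a completely positive map $\psi\colon T\to M_k$ with $\psi f\neq\psi g$.
   Context: A regularly ordered Banach space is a real Banach space $V$ with a closed convex cone $V_+$ such that: (1) $-y\le x\le y$ implies $\|x\|\le\|y\|$; (2) for every $x$ with $\|x\|<1$ there is $y\in V_+$ with $\|y\|<1$ and $-y\le x\le y$. For a complex $*$-vector space $S$, $M_n(S)$ is the $*$-vector space of $n\times n$ matrices over $S$ and $M_n(S)_h$ its Hermitian part. An operator system is a complex $*$-vector space $S$ equipped with a regularly ordered Banach space structure on $M_n(S)_h$ for every $n\ge1$ such that: (i) for all $m,n$ and every scalar matrix $\alpha\in M_{n,m}$ with $\|\alpha\|\le1$, the map $M_n(S)_h\to M_m(S)_h$, $x\mapsto\alpha^*x\alpha$ is positive and contractive; (ii) $\left\|\begin{pmatrix}x&0\\0&x\end{pmatrix}\right\|=\|x\|$ for all $x\in M_n(S)_h$ and all $n$. A morphism of operator systems is a $*$-preserving linear map $f\colon S\to T$ such that the induced map $M_n(f)_h\colon M_n(S)_h\to M_n(T)_h$ is positive and contractive for every $n$. $M_k$ is the algebra of complex $k\times k$ matrices with its usual matrix ordering: $M_n(M_k)_h\cong(M_{nk})_h$ carries the positive semidefinite cone. A completely positive map $T\to M_k$ is a $*$-preserving linear map $\psi$ such that $M_n(\psi)_h$ is positive for every $n$. *)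

(* Defs.v *)
From HB Require Import structures.
From mathcomp Require Import all_boot all_order all_algebra.
From mathcomp Require Import spectral sesquilinear.
From mathcomp Require Import all_classical all_reals all_analysis.
From mathcomp Require Import complex.
Import numFieldNormedType.Exports.

Set Implicit Arguments.
Unset Strict Implicit.
Unset Printing Implicit Defensive.

Import Order.TTheory GRing.Theory Num.Theory.
Local Open Scope classical_set_scope.
Local Open Scope sesquilinear_scope.
Local Open Scope ring_scope.

Record vnorm (R : realType) (V : lmodType R) := VNorm {
  nrm :> V -> R;
  nrmD : forall x y, nrm (x + y) <= nrm x + nrm y;
  nrmZ : forall (a : R) x, nrm (a *: x) = `|a| * nrm x;
  nrm0_eq0 : forall x, nrm x = 0 -> x = 0 }.

(* A copy of [V], carrying the norm topology and uniformity of [N]. *)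
Definition normed_by (R : realType) (V : lmodType R) (N : vnorm V) : Type := V.

HB.instance Definition _ (R : realType) (V : lmodType R) (N : vnorm V) :=
  GRing.Lmodule.on (normed_by N).
HB.instance Definition _ (R : realType) (V : lmodType R) (N : vnorm V) :=
  Lmodule_isNormed.Build R (normed_by N) (@nrmD R V N) (@nrmZ R V N)
    (@nrm0_eq0 R V N).

Record regOrdBanach (R : realType) (V : lmodType R) := RegOrdBanach {
  ro_norm : vnorm V;
  ro_pos : set V;
  ro_complete : forall F : set_system (normed_by ro_norm),
    ProperFilter F -> cauchy F -> cvg F;
  ro_closed : closed (ro_pos : set (normed_by ro_norm));
  ro_pos0 : ro_pos 0;
  ro_posD : forall x y, ro_pos x -> ro_pos y -> ro_pos (x + y);
  ro_posZ : forall (a : R) x, 0 <= a -> ro_pos x -> ro_pos (a *: x);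
  (* The order is [x <= y] iff [y - x] lies in the cone, so that the two
     premises below say [- y <= x] and [x <= y]. *)
  ro_norm_mono : forall x y, ro_pos (x + y) -> ro_pos (y - x) ->
    ro_norm x <= ro_norm y;
  ro_norm_dom : forall x, ro_norm x < 1 ->
    exists y, [/\ ro_pos y, ro_norm y < 1, ro_pos (x + y) & ro_pos (y - x)] }.

HB.mixin Record isStarSpace (R : realType) S & GRing.Lmodule R[i] S := {
  star : S -> S;
  starK : involutive star;
  starD : {morph star : x y / x + y};
  starZ : forall (a : R[i]) (x : S), star (a *: x) = a^* *: star x }.

#[short(type="starSpaceType")]
HB.structure Definition StarSpace (R : realType) :=
  {S of GRing.Lmodule R[i] S & isStarSpace R S}.

HB.mixin Record isStarPreserving (R : realType) (S T : starSpaceType R)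
    (f : S -> T) := {
  star_morph : {morph f : x / star x} }.

#[short(type="starLinearType")]
HB.structure Definition StarLinear (R : realType) (S T : starSpaceType R) :=
  {f of @GRing.Linear R[i] S T *:%R f & isStarPreserving R S T f}.

Lemma star0 (R : realType) (S : starSpaceType R) : star (0 : S) = 0.
Proof. by apply: (@addrI _ (star 0)); rewrite -starD !addr0. Qed.

Lemma starN (R : realType) (S : starSpaceType R) (x : S) :
  star (- x) = - star x.
Proof. by apply/eqP; rewrite -subr_eq0 opprK -starD addNr star0. Qed.

Lemma star_sum (R : realType) (S : starSpaceType R) I (r : seq I) (F : I -> S) :
  star (\sum_(i <- r) F i) = \sum_(i <- r) star (F i).
Proof. exact: (big_morph _ (@starD R S) (@star0 R S)). Qed.

Section Hermitian.
Context (R : realType) (S : starSpaceType R).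

Definition mxstar n (A : 'M[S]_n) : 'M[S]_n := \matrix_(i, j) star (A j i).

Definition herm_pred n : pred 'M[S]_n := [pred A | mxstar A == A].

Record hermmx n := HermMx { hermval :> 'M[S]_n; hermP : herm_pred hermval }.

HB.instance Definition _ n := [isSub for @hermval n].
HB.instance Definition _ n := [Choice of hermmx n by <:].

Lemma herm_zmod_closed n : zmod_closed (@herm_pred n).
Proof.
split=> [|A B /eqP hA /eqP hB]; apply/eqP/matrixP => i j; rewrite !mxE.
  exact: star0.
by rewrite starD starN -{2}hA -{2}hB !mxE.
Qed.

HB.instance Definition _ n :=
  GRing.isZmodClosed.Build 'M[S]_n (@herm_pred n) (@herm_zmod_closed n).
HB.instance Definition _ n := [SubChoice_isSubZmodule of hermmx n by <:].

(* Real scalars act on Hermitian matrices through [R] inside [R[i]]. *)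
Fact hermscale_subproof n (a : R) (x : hermmx n) :
  herm_pred (map_mx (fun s : S => a%:C%C *: s) x).
Proof.
apply/eqP/matrixP => i j; rewrite !mxE starZ -{2}(eqP (hermP x)) mxE.
by congr (_ *: _); apply: conj_Creal; rewrite complex_real.
Qed.

Definition hermscale n (a : R) (x : hermmx n) : hermmx n :=
  HermMx (hermscale_subproof a x).

Fact hermscaleA n a b (x : hermmx n) :
  hermscale a (hermscale b x) = hermscale (a * b) x.
Proof. by apply/val_inj/matrixP => i j; rewrite !mxE scalerA rmorphM. Qed.

Fact hermscale1 n : left_id 1 (@hermscale n).
Proof. by move=> x; apply/val_inj/matrixP => i j; rewrite !mxE scale1r. Qed.

Fact hermscaleDr n : right_distributive (@hermscale n) +%R.
Proof. by move=> a x y; apply/val_inj/matrixP => i j; rewrite !mxE scalerDr. Qed.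

Fact hermscaleDl n (x : hermmx n) : {morph (@hermscale n)^~ x : a b / a + b}.
Proof.
by move=> a b; apply/val_inj/matrixP => i j; rewrite !mxE rmorphD scalerDl.
Qed.

HB.instance Definition _ n := GRing.Zmodule_isLmodule.Build R (hermmx n)
  (@hermscaleA n) (@hermscale1 n) (@hermscaleDr n) (@hermscaleDl n).

(* [alpha^* x alpha] *)
Definition mxcompr n m (alpha : 'M[R[i]]_(n, m)) (A : 'M[S]_n) : 'M[S]_m :=
  \matrix_(i, j) \sum_k \sum_l ((alpha k i)^* * alpha l j) *: A k l.

Fact hermcompr_subproof n m (alpha : 'M[R[i]]_(n, m)) (x : hermmx n) :
  herm_pred (mxcompr alpha x).
Proof.
apply/eqP/matrixP => i j; rewrite !mxE star_sum [RHS]exchange_big /=.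
apply: eq_bigr => k _; rewrite star_sum; apply: eq_bigr => l _.
by rewrite starZ rmorphM /= conjCK mulrC -{2}(eqP (hermP x)) mxE.
Qed.

Definition hermcompr n m (alpha : 'M[R[i]]_(n, m)) (x : hermmx n) : hermmx m :=
  HermMx (hermcompr_subproof alpha x).

Fact hermdiag_subproof n (x : hermmx n) :
  herm_pred (block_mx x 0 0 x : 'M[S]_(n + n)).
Proof.
have E i j : star (hermval x j i) = x i j by rewrite -{2}(eqP (hermP x)) mxE.
apply/eqP/matrixP => i j; rewrite mxE.
by case: (split_ordP i) => i' ->; case: (split_ordP j) => j' ->;
  rewrite ?(block_mxEul, block_mxEur, block_mxEdl, block_mxEdr) ?mxE ?star0.
Qed.

Definition hermdiag n (x : hermmx n) : hermmx (n + n) :=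
  HermMx (hermdiag_subproof x).

End Hermitian.

Section HermitianMap.
Context (R : realType) (S T : starSpaceType R) (f : starLinearType S T).

Fact hermmap_subproof n (x : hermmx S n) : herm_pred (map_mx f x).
Proof.
by apply/eqP/matrixP => i j; rewrite !mxE -star_morph -{2}(eqP (hermP x)) mxE.
Qed.

Definition hermmap n (x : hermmx S n) : hermmx T n :=
  HermMx (hermmap_subproof x).

End HermitianMap.

Definition l2norm (R : realType) n (v : 'cV[R[i]]_n) : R :=
  Num.sqrt (\sum_i Normc.normc (v i 0) ^+ 2).

Definition opnorm (R : realType) n m (alpha : 'M[R[i]]_(n, m)) : R :=
  sup [set l2norm (alpha *m v) | v in [set v | l2norm v <= 1]].

HB.mixin Record isOperatorSystem (R : realType) S & StarSpace R S := {
  mxro : forall n, regOrdBanach (hermmx S n.+1);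
  mxro_compr_pos : forall n m (alpha : 'M[R[i]]_(n.+1, m.+1)),
    opnorm alpha <= 1 -> forall x, ro_pos (mxro n) x ->
    ro_pos (mxro m) (hermcompr alpha x);
  mxro_compr_norm : forall n m (alpha : 'M[R[i]]_(n.+1, m.+1)),
    opnorm alpha <= 1 -> forall x,
    ro_norm (mxro m) (hermcompr alpha x) <= ro_norm (mxro n) x;
  (* [n.+1 + n.+1] reduces to [(n + n.+1).+1] *)
  mxro_diag_norm : forall n (x : hermmx S n.+1),
    ro_norm (mxro (n + n.+1)) (hermdiag x) = ro_norm (mxro n) x }.

#[short(type="opSystemType")]
HB.structure Definition OperatorSystem (R : realType) :=
  {S of StarSpace R S & isOperatorSystem R S}.

Definition mxpos (R : realType) (S : opSystemType R) n : set (hermmx S n.+1) :=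
  ro_pos (mxro n).

Definition mxnorm (R : realType) (S : opSystemType R) n : hermmx S n.+1 -> R :=
  ro_norm (mxro n).

Definition opsys_morphism (R : realType) (S T : opSystemType R)
    (f : starLinearType S T) : Prop :=
  forall n (x : hermmx S n.+1),
    (mxpos x -> mxpos (hermmap f x)) /\ mxnorm (hermmap f x) <= mxnorm x.

Section MatrixStar.
Context (R : realType) (k : nat).

Fact mxadjK : involutive (fun A : 'M[R[i]]_k => A ^t*).
Proof. exact: trmxCK. Qed.

Fact mxadjD : {morph (fun A : 'M[R[i]]_k => A ^t*) : A B / A + B}.
Proof. by move=> A B; rewrite linearD /= map_mxD. Qed.

Fact mxadjZ (a : R[i]) (A : 'M[R[i]]_k) : (a *: A) ^t* = a^* *: A ^t*.
Proof. by rewrite linearZ /= map_mxZ. Qed.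

HB.instance Definition _ :=
  isStarSpace.Build R 'M[R[i]]_k mxadjK mxadjD mxadjZ.

End MatrixStar.

Definition psdmx (R : realType) n (A : 'M[R[i]]_n) : Prop :=
  A \is hermsymmx /\ forall v : 'cV[R[i]]_n, 0 <= (v ^t* *m A *m v) 0 0.

(* The cone of [M_n(M_k)_h]: a matrix of matrices is flattened into a block
   matrix, whose size [\sum_(i < n) k] is [n * k]. *)
Definition mxalg_pos (R : realType) k n (x : hermmx 'M[R[i]]_k n) : Prop :=
  psdmx (\mxblock_(i < n, j < n) hermval x i j).

Definition completely_positive (R : realType) (T : opSystemType R) k
    (psi : starLinearType T 'M[R[i]]_k) : Prop :=
  forall n (x : hermmx T n.+1), mxpos x -> mxalg_pos (hermmap psi x).

(* Main.v *)
(* Already [k = 1] suffices. The cone of [T_h] is closed and proper, so by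
   Hahn-Banach positive functionals [phi] on [T_h] separate its points. The
   complex-linear extension [psi] of such a [phi] to [T] is automatically
   completely positive: for [x >= 0] in [M_n(T)] and [v] in [C^n],
   [v^* M_n(psi)(x) v = psi (v^* x v) >= 0]. Hahn-Banach itself is obtained from
   Zorn's lemma applied to sublinear functionals, a minimal one being linear. *)
Require Import Defs.
From HB Require Import structures.
From mathcomp Require Import all_boot all_order all_algebra.
From mathcomp Require Import spectral sesquilinear.
From mathcomp Require Import all_classical all_reals all_analysis.
From mathcomp Require Import complex ring lra.

Set Implicit Arguments.
Unset Strict Implicit.
Unset Printing Implicit Defensive.

Import Order.TTheory GRing.Theory Num.Theory.
Import numFieldNormedType.Exports.

Local Open Scope classical_set_scope.
Local Open Scope sesquilinear_scope.
Local Open Scope ring_scope.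

(** * Sublinear functionals and their infima *)

Definition sublinear (R : realType) (V : lmodType R) (q : V -> R) : Prop :=
  (forall x y, q (x + y) <= q x + q y) /\
  (forall t x, 0 < t -> q (t *: x) <= t * q x).

Section Sublinear.
Context (R : realType) (V : lmodType R) (q : V -> R) (hq : sublinear q).

(** The defining inequality, which is the form that infima deliver, is also applied to [t^-1]. *)
Lemma sublinearZ t x : 0 < t -> q (t *: x) = t * q x.
Proof.
move=> t0; apply/eqP; rewrite eq_le hq.2 //=.
have := hq.2 t^-1 (t *: x); rewrite invr_gt0 scalerA mulVf ?gt_eqF// scale1r.
by move=> /(_ t0); rewrite ler_pdivlMl.
Qed.

Lemma sublinear0 : q 0 = 0.
Proof. by have := sublinearZ 0 (ltr0n R 2); rewrite scaler0; lra. Qed.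

Lemma sublinear_geN x : - q (- x) <= q x.
Proof. by have := hq.1 x (- x); rewrite subrr sublinear0; lra. Qed.

End Sublinear.

(** Serves three infima: tilts, chains in Zorn's lemma and the distance to a cone. The index [k] may
    depend on the points: it is the smaller member of a chain, or a sum or multiple of the given
    indices. *)
Lemma sublinear_inf (R : realType) (V : lmodType R) (I : Type) (A : set I)
    (F : I -> V -> R) (i0 : I) :
    A i0 ->
    (forall x, has_lbound [set F i x | i in A]) ->
    (forall i j x y, A i -> A j ->
      exists2 k, A k & F k (x + y) <= F i x + F j y) ->
    (forall i t x, A i -> 0 < t -> exists2 k, A k & F k (t *: x) <= t * F i x) ->
  sublinear (fun x => inf [set F i x | i in A]).
Proof.
move=> Ai0 Flb FD FZ.
have Fne x : [set F i x | i in A] !=set0 by exists (F i0 x), i0.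
have infF k x : A k -> inf [set F i x | i in A] <= F k x.
  by move=> Ak; apply: ge_inf => //; exists k.
split=> [x y|t x t0] /=.
  rewrite -lerBlDr; apply: lb_le_inf => // _ [i Ai <-].
  rewrite lerBlDr -lerBlDl; apply: lb_le_inf => // _ [j Aj <-].
  rewrite lerBlDl; have [k Ak] := FD i j x y Ai Aj.
  exact: le_trans (infF _ _ Ak).
rewrite -ler_pdivrMl//; apply: lb_le_inf => // _ [i Ai <-].
rewrite ler_pdivrMl//; have [k Ak] := FZ i t x Ai t0.
exact: le_trans (infF _ _ Ak).
Qed.

(* The largest sublinear functional below [q] whose value at [- a] is at most
   [- q a]; hence a minimal sublinear [q] equals all its tilts, which makes it
   additive. *)
Definition tilt (R : realType) (V : lmodType R) (q : V -> R) (a x : V) : R :=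
  inf [set q (x + t *: a) - t * q a | t in [set t : R | 0 <= t]].

Section Tilt.
Context (R : realType) (V : lmodType R) (q : V -> R) (hq : sublinear q).
Variable a : V.

Let tilt_lb x :
  has_lbound [set q (x + t *: a) - t * q a | t in [set t : R | 0 <= t]].
Proof.
(* By subadditivity [t * q a = q (t *: a) <= q (x + t *: a) + q (- x)]. *)
exists (- q (- x)) => _ [t /= t0 <-].
have := hq.1 (x + t *: a) (- x); rewrite addrAC subrr add0r.
have [->|tn0] := eqVneq t 0.
  by rewrite scale0r addr0 mul0r (sublinear0 hq); lra.
by rewrite (sublinearZ hq) ?lt0r ?tn0//; lra.
Qed.

Lemma tilt_sublinear : sublinear (tilt q a).
Proof.
apply: (sublinear_inf (i0 := 0)) => //= [s t x y s0 t0|s t x s0 t0].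
  exists (s + t); first exact: addr_ge0.
  by have := hq.1 (x + s *: a) (y + t *: a); rewrite addrACA -scalerDl; lra.
exists (t * s); first by rewrite mulr_ge0 // ltW.
by have := hq.2 t (x + s *: a) t0; rewrite scalerDr scalerA; lra.
Qed.

Lemma tilt_le x t : 0 <= t -> tilt q a x <= q (x + t *: a) - t * q a.
Proof. by move=> t0; apply: ge_inf => //; exists t. Qed.

Lemma tilt_le_id x : tilt q a x <= q x.
Proof. by have := tilt_le x (lexx 0); rewrite scale0r addr0 mul0r subr0. Qed.

End Tilt.

(** * Hahn-Banach through minimal sublinear functionals *)

Lemma minimal_sublinear (R : realType) (V : lmodType R) (p : V -> R) :
    sublinear p ->
  exists q, [/\ sublinear q, forall x, q x <= p x &
    forall r, sublinear r -> (forall x, r x <= q x) ->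
      forall x, q x <= r x].
Proof.
move=> hp.
pose P q := sublinear q /\ forall x : V, q x <= p x.
pose T := {q | P q}.
(* The order is reversed, so that the maximal element given by Zorn's lemma is a minimal
   functional. *)
pose le_rel (q r : T) := `[< forall x, sval r x <= sval q x >].
have := @ZL_preorder T (exist P p (conj hp (fun=> lexx _))) le_rel.
case=> [q|q r s /asboolP qr /asboolP rs|A Atot|[q [hq qp]] qmin].
- by apply/asboolP.
- by apply/asboolP => x; apply: le_trans (qr x).
- have [[i0 Ai0]|A0] := pselect (exists i, A i); last first.
    exists (exist P p (conj hp (fun=> lexx _))) => q Aq.
    by exfalso; apply: A0; exists q.
  have Alb x : has_lbound [set sval q x | q in A].
    (* [- p (- x) <= - q (- x) <= q x], uniformly over the chain. *)
    exists (- p (- x)) => _ [[q [hq qp]] _ <-] /=.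
    by apply: le_trans (sublinear_geN hq x); rewrite lerN2.
  have hr : sublinear (fun x => inf [set sval q x | q in A]).
    apply: (sublinear_inf (i0 := i0)) => // [i j x y Ai Aj|i t x Ai t0].
      have [/asboolP le|/asboolP le] := Atot _ _ Ai Aj.
        exists j => //; apply: le_trans ((svalP j).1.1 x y) _.
        by rewrite lerD2r.
      exists i => //; apply: le_trans ((svalP i).1.1 x y) _.
      by rewrite lerD2l.
    by exists i => //; apply: (svalP i).1.2.
  have rA q x : A q -> inf [set sval q x | q in A] <= sval q x.
    by move=> Aq; apply: ge_inf => //; exists q.
  have rp x : inf [set sval q x | q in A] <= p x.
    exact: le_trans (rA _ _ Ai0) ((svalP i0).2 x).
  by exists (exist P _ (conj hr rp)) => q Aq; apply/asboolP => x; apply: rA.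
exists q; split=> // r hr rq.
have rp x : r x <= p x by apply: le_trans (qp x).
have := qmin (exist P r (conj hr rp)); rewrite /le_rel /=.
by move=> h; apply/asboolP/h/asboolP.
Qed.

Lemma linear_below_sublinear (R : realType) (V : lmodType R) (p : V -> R)
    (a : V) : sublinear p ->
  exists phi : {linear V -> R^o}, (forall x, phi x <= p x) /\ phi a = p a.
Proof.
move=> hp.
(* Starting from the tilt of [p] rather than from [p] forces equality at [a]:
   [q (- a) <= tilt p a (- a) <= - p a], so [p a <= q a] once [q] is odd. *)
have [q [hq qle qmin]] := minimal_sublinear (tilt_sublinear hp a).
have qD x y : q (x + y) = q x + q y.
  apply/eqP; rewrite eq_le hq.1 /=.
  have := qmin _ (tilt_sublinear hq y) (tilt_le_id hq y) x.
  have := tilt_le hq y x ler01; rewrite scale1r mul1r; lra.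
have qN x : q (- x) = - q x.
  by have := qD x (- x); rewrite subrr (sublinear0 hq); lra.
have qp x : q x <= p x := le_trans (qle x) (tilt_le_id hp a x).
have qZ t x : q (t *: x) = t * q x.
  have [t0|t0|->] := ltgtP t 0; first 1 last.
  - exact: sublinearZ.
  - by rewrite scale0r mul0r (sublinear0 hq).
  rewrite -[t]opprK scaleNr qN (sublinearZ hq) ?oppr_gt0 //.
  by rewrite -mulNr.
have qlin : linear_for ( *:%R : R -> R^o -> R^o) q.
  by move=> t x y; rewrite qD qZ.
pose qL := GRing.isLinear.Build R V R^o *:%R q qlin.
exists (HB.pack_for {linear V -> R^o} q qL); split=> //=.
apply/eqP; rewrite eq_le qp /=.
have := tilt_le hp a (- a) ler01.
rewrite scale1r mul1r addNr (sublinear0 hp).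
by have := qle (- a); rewrite qN; lra.
Qed.

(** * Positive functionals separate points *)

Lemma cone_separation (R : realType) (V : lmodType R) (N : vnorm V)
    (K : set V) (e : R) (a : V) :
    K 0 -> (forall x y, K x -> K y -> K (x + y)) ->
    (forall t x, 0 <= t -> K x -> K (t *: x)) ->
    0 < e -> (forall x, K x -> e <= N (x - a)) ->
  exists phi : {linear V -> R^o}, (forall x, K x -> 0 <= phi x) /\ phi a < 0.
Proof.
move=> K0 KD KZ e0 Ke.
have N0 : N 0 = 0 by rewrite -(scale0r (0 : V)) nrmZ normr0 mul0r.
have N_ge0 x : 0 <= N x.
  have := nrmD N x (- x); rewrite subrr N0 -scaleN1r nrmZ normrN1 mul1r; lra.
(* [p x] is the distance from [- x] to [K], hence [p (- x) <= 0] for [x] in [K] and [e <= p (- a)].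
   A linear functional below [p], equal to it at [- a], separates. *)
pose p x := inf [set N (x + c) | c in K].
have plb x : has_lbound [set N (x + c) | c in K].
  by exists 0 => _ [c _ <-].
have hp : sublinear p.
  apply: (sublinear_inf (i0 := 0)) => // [c d x y Kc Kd|c t x Kc t0].
    by exists (c + d); [exact: KD|rewrite addrACA nrmD].
  exists (t *: c); first by apply: KZ => //; exact: ltW.
  by rewrite -scalerDr nrmZ gtr0_norm.
have [phi [phip phia]] := linear_below_sublinear (- a) hp.
exists phi; split=> // [x Kx|].
  rewrite -oppr_le0 -linearN (le_trans (phip _))// -N0 -(addNr x).
  by apply: ge_inf => //; exists x.
rewrite -oppr_gt0 -linearN phia; apply: (lt_le_trans e0).
apply: lb_le_inf; first by exists (N (- a + 0)), 0.
by move=> _ [c Kc <-]; rewrite addrC Ke.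
Qed.

(** The cone is proper: if it contains both [a] and [- a], monotonicity of the norm with [y = 0]
    gives [a = 0]. Otherwise one of them lies outside the closed cone, at positive distance from
    it. *)
Lemma ro_pos_separating (R : realType) (V : lmodType R) (B : regOrdBanach V)
    (a : V) : a != 0 ->
  exists phi : {linear V -> R^o},
    (forall x, ro_pos B x -> 0 <= phi x) /\ phi a != 0.
Proof.
have main b : ~ ro_pos B b -> exists phi : {linear V -> R^o},
    (forall x, ro_pos B x -> 0 <= phi x) /\ phi b < 0.
  move=> Kb.
  have /nbhs_ballP[e /= e0 he] : nbhs (b : normed_by (ro_norm B)) (~` ro_pos B).
    apply: open_nbhs_nbhs; split => //; apply: closed_openC; exact: ro_closed.
  apply: (cone_separation (N := ro_norm B) (e := e)) => //.
  - exact: ro_pos0.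
  - exact: ro_posD.
  - exact: ro_posZ.
  move=> x Kx; rewrite leNgt; apply/negP => lt; apply: (he x) Kx.
  by rewrite -ball_normE /ball_ /= distrC; exact: lt.
move=> an0; have [Ka|/main[phi [? pa]]] := pselect (ro_pos B a); last first.
  by exists phi; split=> //; rewrite lt_eqF.
have [KNa|/main[phi [? pa]]] := pselect (ro_pos B (- a)); last first.
  exists phi; split=> //; apply: contraTN pa => /eqP pa.
  by rewrite linearN pa oppr0 ltxx.
case/eqP: an0; apply: (@nrm0_eq0 _ _ (ro_norm B)).
have N0 : ro_norm B 0 = 0 by rewrite -(scale0r (0 : V)) nrmZ normr0 mul0r.
have := @ro_norm_mono _ _ B a 0; rewrite addr0 sub0r N0 => /(_ Ka KNa).
have := nrmD (ro_norm B) a (- a); rewrite subrr N0 -scaleN1r nrmZ normrN1; lra.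
Qed.

(** * Real parts and complex-linear extension *)

Section DoubleRealPart.
Context (R : realType) (S : starSpaceType R).

Fact herm2_subproof (x : S) : herm_pred (const_mx (x + star x) : 'M[S]_1).
Proof.
by apply/eqP/matrixP => i j; rewrite !mxE starD starK addrC.
Qed.

(** Twice the real part of [x], which avoids halving, placed in the [1 x 1] matrices because the
    order lives there. *)
Definition herm2 (x : S) : hermmx S 1 := HermMx (herm2_subproof x).

Lemma herm2D : {morph herm2 : x y / x + y}.
Proof.
by move=> x y; apply/val_inj/matrixP => i j; rewrite !mxE starD addrACA.
Qed.

Lemma herm2Zreal (a : R) x : herm2 (a%:C%C *: x) = a *: herm2 x.
Proof.
apply/val_inj/matrixP => i j; rewrite !mxE starZ scalerDr.
by rewrite conj_Creal ?complex_real.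
Qed.

Lemma herm2N x : herm2 (- x) = - herm2 x.
Proof.
by apply/val_inj/matrixP => i j; rewrite !mxE starN opprD.
Qed.

Lemma herm2_star x : herm2 (star x) = herm2 x.
Proof. by apply/val_inj/matrixP => i j; rewrite !mxE starK addrC. Qed.

Lemma conj_imaginary : ('i%C : R[i])^* = - 'i%C.
Proof. by apply/eqP; rewrite eq_complex /= oppr0 !eqxx. Qed.

Lemma herm2_istar x : herm2 ('i%C *: star x) = - herm2 ('i%C *: x).
Proof.
apply/val_inj/matrixP => i j; rewrite !mxE !starZ starK conj_imaginary.
by rewrite !scaleNr opprD opprK addrC.
Qed.

Lemma herm2_herm (x : hermmx S 1) : herm2 (x 0 0) = x + x.
Proof.
apply/val_inj/matrixP => i j; rewrite !mxE !ord1.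
by rewrite -{2}(eqP (hermP x)) mxE starK.
Qed.

Lemma herm2_iherm (x : hermmx S 1) : herm2 ('i%C *: x 0 0) = 0.
Proof.
apply/val_inj/matrixP => i j; rewrite !mxE starZ conj_imaginary.
by rewrite -{1}(eqP (hermP x)) mxE scaleNr subrr.
Qed.

(** The first hypothesis says [star x = - x]; the second then reads [2 i x = 0]. *)
Lemma herm2_eq0 x : herm2 x = 0 -> herm2 ('i%C *: x) = 0 -> x = 0.
Proof.
move=> /(congr1 val)/matrixP/(_ 0 0); rewrite !mxE => /eqP.
rewrite addr_eq0 => /eqP xs.
move=> /(congr1 val)/matrixP/(_ 0 0); rewrite !mxE starZ conj_imaginary => /eqP.
rewrite scaleNr -scalerN -xs -scalerDr scaler_eq0 => /orP[|].
  by rewrite eq_complex /= oner_eq0 andbF.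
by rewrite -mulr2n -scaler_nat scaler_eq0 pnatr_eq0 => /eqP.
Qed.

End DoubleRealPart.

Section Complexification.
Context (R : realType) (S : starSpaceType R) (phi : {linear hermmx S 1 -> R^o}).

(* The complex-linear extension of [phi], up to a factor [2]; the imaginary part
   of [x] is minus the real part of [i x]. *)
Definition complexified (x : S) : 'M[R[i]]_1 :=
  (phi (herm2 x) +i* - phi (herm2 ('i%C *: x)))%C%:M.

Lemma complexified_linear : linear complexified.
Proof.
move=> a x y; rewrite /complexified -scalemx1 -[in RHS]scalemx1.
rewrite -[X in _ = _ + X]scalemx1 scalerA -scalerDl; congr (_ *: _).
case: a => b c.
(* [phi] and [herm2] are only real-linear, so the scalar is split into its real and imaginary
   parts. *)
have E z : (b +i* c)%C *: z = b%:C%C *: z + c%:C%C *: ('i%C *: z) :> S.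
  rewrite scalerA -scalerDl; congr (_ *: _).
  by apply/eqP; rewrite eq_complex /=; apply/andP; split; apply/eqP; ring.
have ii z : 'i%C *: ('i%C *: z) = - z :> S.
  rewrite scalerA -scaleN1r; congr (_ *: _).
  by apply/eqP; rewrite eq_complex /=; apply/andP; split; apply/eqP; ring.
rewrite scalerDr scalerA mulrC -scalerA !E ii.
rewrite !herm2D !herm2Zreal herm2N !linearD !linearZ linearN /=.
by apply/eqP; rewrite eq_complex /=; apply/andP; split; apply/eqP;
  rewrite /GRing.scale /=; ring.
Qed.

HB.instance Definition _ :=
  GRing.isLinear.Build R[i] S 'M[R[i]]_1 *:%R complexified complexified_linear.

Lemma complexified_star : {morph complexified : x / star x}.
Proof.
move=> x; rewrite /complexified herm2_star herm2_istar linearN.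
apply/matrixP => i j; rewrite !mxE !ord1 !mulr1n.
by apply/eqP; rewrite eq_complex /= !eqxx.
Qed.

HB.instance Definition _ :=
  isStarPreserving.Build R S 'M[R[i]]_1 complexified complexified_star.

Lemma complexified_herm (x : hermmx S 1) :
  complexified (x 0 0) = (2 * phi x)%:C%C%:M.
Proof.
rewrite /complexified herm2_herm herm2_iherm linearD linear0 oppr0.
by rewrite mulr2n mulrDl mul1r.
Qed.

Lemma complexified_eq0 x : complexified x = 0 ->
  phi (herm2 x) = 0 /\ phi (herm2 ('i%C *: x)) = 0.
Proof.
move=> /matrixP/(_ 0 0); rewrite !mxE => /eqP; rewrite eq_complex /=.
by rewrite oppr_eq0 => /andP[/eqP-> /eqP->].
Qed.

End Complexification.

(** * Compression by columns and complete positivity *)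

Lemma l2norm_ge0 (R : realType) n (v : 'cV[R[i]]_n) : 0 <= l2norm v.
Proof. exact: sqrtr_ge0. Qed.

Lemma normc_ge0 (R : realType) (x : R[i]) : 0 <= Normc.normc x.
Proof. by case: x => a b; exact: sqrtr_ge0. Qed.

Lemma l2normZ (R : realType) n (a : R[i]) (v : 'cV[R[i]]_n) :
  l2norm (a *: v) = Normc.normc a * l2norm v.
Proof.
rewrite /l2norm; under eq_bigr do rewrite mxE Normc.normcM exprMn.
by rewrite -mulr_sumr sqrtrM ?sqr_ge0// sqrtr_sqr ger0_norm ?normc_ge0.
Qed.

Lemma l2norm1 (R : realType) (v : 'cV[R[i]]_1) : l2norm v = Normc.normc (v 0 0).
Proof. by rewrite /l2norm big_ord1 sqrtr_sqr ger0_norm ?normc_ge0. Qed.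

(** A vector of length one is a scalar, so the column acts by scaling itself. *)
Lemma opnorm_col (R : realType) n (alpha : 'cV[R[i]]_n) :
  l2norm alpha <= 1 -> opnorm alpha <= 1.
Proof.
move=> a1; apply: ge_sup.
  by exists (l2norm (alpha *m 0)), 0 => //=; rewrite l2norm1 mxE Normc.normc0.
move=> _ [v /= v1 <-]; rewrite [v]mx11_scalar mul_mx_scalar l2normZ.
by rewrite mulr_ile1 ?normc_ge0 ?l2norm_ge0 -?l2norm1.
Qed.

(* The axiom only covers contractions, so [alpha] is rescaled. *)
Lemma mxpos_compr_col (R : realType) (T : opSystemType R) n
    (alpha : 'cV[R[i]]_n.+1) (x : hermmx T n.+1) :
  mxpos x -> mxpos (hermcompr alpha x : hermmx T 1).
Proof.
(* The summand [1] keeps [c] invertible when [alpha] is zero. *)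
move=> xpos; pose c : R := 1 + l2norm alpha.
have c0 : 0 < c by rewrite ltr_pwDl ?l2norm_ge0.
pose beta := (c^-1)%:C%C *: alpha.
have b1 : opnorm beta <= 1.
  apply: opnorm_col; rewrite l2normZ /= expr0n addr0 sqrtr_sqr.
  by rewrite ger0_norm ?invr_ge0 ?(ltW c0)// ler_pdivrMl// mulr1 lerDr.
(* Compression is quadratic in the column and [alpha] is [c] times [beta]. *)
have -> : hermcompr alpha x = c ^+ 2 *: (hermcompr beta x : hermmx T 1).
  apply/val_inj/matrixP => i j; rewrite !mxE scaler_sumr.
  apply: eq_bigr => k _; rewrite scaler_sumr; apply: eq_bigr => l _.
  rewrite scalerA !mxE [in RHS](rmorphM (@Num.conj R[i])) /=.
  rewrite (@conj_Creal _ (c^-1)%:C%C) ?complex_real //; congr (_ *: _).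
  have cc : c%:C%C * (c^-1)%:C%C = 1 :> R[i].
    by rewrite -rmorphM /= divff ?gt_eqF.
  rewrite rmorphXn /=.
  transitivity ((c%:C%C * (c^-1)%:C%C) ^+ 2 * ((alpha k i)^* * alpha l j)).
    by rewrite cc expr1n mul1r.
  by ring.
by apply: ro_posZ; [exact: sqr_ge0|exact: mxro_compr_pos].
Qed.

Lemma complexified_cp (R : realType) (T : opSystemType R)
    (phi : {linear hermmx T 1 -> R^o}) :
    (forall x, mxpos x -> 0 <= phi x) ->
  completely_positive (complexified phi : starLinearType T 'M[R[i]]_1).
Proof.
move=> phipos n x xpos.
rewrite /mxalg_pos; set A := (X in psdmx X).
have AE s t :
    A s t = complexified phi (x (tagnat.sig1 s) (tagnat.sig1 t)) 0 0.
  by rewrite mxE mxE; congr (_ _ _); rewrite !ord1.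
split.
  apply/is_hermitianmxP; rewrite expr0 scale1r; apply/matrixP => s t.
  rewrite AE [RHS]mxE [in RHS]mxE AE.
  rewrite -{1}(eqP (hermP x)) [mxstar _ _ _]mxE star_morph.
  by rewrite !mxE.
move=> v.
(* The flattened matrix is indexed by ordinals below a sum of [n.+1] ones; [tagnat.Rank i 0] matches
   them with ['I_n.+1], and [alpha] is [v] reindexed this way. *)
pose alpha : 'cV[R[i]]_n.+1 := \col_i v (tagnat.Rank i 0) 0.
have reidx (F : 'I_(\sum_(i < n.+1) 1) -> R[i]) :
    \sum_s F s = \sum_(i < n.+1) F (tagnat.Rank i 0).
  rewrite (reindex (fun i : 'I_n.+1 => tagnat.Rank (p_ := fun=> 1) i 0)) //=.
  apply: onW_bij; exists (@tagnat.sig1 n.+1 (fun=> 1%N)) => [i|s].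
    exact: tagnat.Rank1K.
  by rewrite -[RHS]tagnat.sig2K; congr tagnat.Rank; rewrite ord1.
have -> : (v ^t* *m A *m v) 0 0 =
    complexified phi (hermcompr alpha x 0 0) 0 0.
  rewrite mxE reidx [X in complexified phi X]mxE linear_sum summxE /=.
  rewrite [RHS](eq_bigr (fun i => \sum_l
    (alpha i 0)^* * alpha l 0 * complexified phi (x i l) 0 0)); last first.
    move=> i _; rewrite linear_sum summxE; apply: eq_bigr => l _.
    by rewrite linearZ mxE.
  rewrite exchange_big /=; apply: eq_bigr => l _.
  rewrite mxE reidx mulr_suml; apply: eq_bigr => i _.
  by rewrite AE !mxE !tagnat.Rank1K mulrAC.
(* On a Hermitian argument the extension is the real number [2 * phi]. *)
rewrite complexified_herm mxE mulr1n ler0c mulr_ge0//.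
exact/phipos/mxpos_compr_col.
Qed.

Theorem corollary5p2p8 (R : realType) (S T : opSystemType R)
    (f g : starLinearType S T) (hf : opsys_morphism f) (hg : opsys_morphism g)
    (hfg : (f : S -> T) <> (g : S -> T)) :
  exists (k : nat) (psi : starLinearType T 'M[R[i]]_k),
    completely_positive psi /\ psi \o f <> psi \o g.
Proof.
have [s fgs] : exists s, f s - g s != 0.
  apply: contrapT => nex; apply: hfg; apply/funext => s.
  by apply/eqP; rewrite -subr_eq0;
    apply: contrapT => /negP fgs; apply: nex; exists s.
(* The real and imaginary parts of [f s - g s] cannot both vanish; [y] is a nonzero one, up to a
   real factor. *)
have [y yE y0] : exists2 y, y = herm2 (f s - g s) \/
    y = herm2 ('i%C *: (f s - g s)) & y != 0.
  have [h1|] := eqVneq (herm2 (f s - g s)) 0; last first.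
    by exists (herm2 (f s - g s)); [left|].
  exists (herm2 ('i%C *: (f s - g s))); first by right.
  by apply: contra fgs => /eqP h2; apply/eqP; exact: herm2_eq0.
(* Sizes are shifted by one, so [mxro 0] is the structure on [hermmx T 1]. *)
have [phi [phipos phiy]] := ro_pos_separating (mxro 0) y0.
exists 1, (complexified phi); split; first exact: complexified_cp.
move=> /(congr1 (fun h => h s)) /= /eqP.
(* If the composites agreed at [s], [phi] would vanish on both candidates for [y]. *)
rewrite -subr_eq0 -linearB => /eqP/complexified_eq0[h1 h2].
by case: yE phiy => ->; rewrite ?h1 ?h2 eqxx.
Qed.
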